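(* Let $Q_z$ be the linear operator on $\mathbb{C}[x_1,\ldots,x_n]^{S_n}$ defined by $Q_z\bar m_\lambda=q_\lambda(z)\bar m_\lambda$ with $q_\lambda(z)=\bar m_\lambda(z,1,\ldots,1)$, and let $\mathcal S_n=\rho_0Q_{z_1}\cdots Q_{z_n}$ be the corresponding separating operator, which satisfies $\mathcal S_n:\bar m_\lambda\mapsto\prod_{j=1}^n q_\lambda(z_j)$ for every partition $\lambda$ of length $n$. Then for each $k=1,\ldots,n$ there exists a uniquely defined linear operator $$\mathcal A_k:\mathbb{C}[x_1,\ldots,x_k]^{S_k}\to\mathbb{C}[x_1,\ldots,x_{k-1}]^{S_{k-1}}\otimes\mathbb{C}[z_k]$$ such that $$\rho_{k-1}Q_{z_k}=\mathcal A_k\rho_k\qquad\text{on }\ \mathbb{C}[x_1,\ldots,x_n]^{S_n}.$$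
   Context: Partitions of length $n$ are $\lambda=(\lambda_1,\ldots,\lambda_n)\in\mathbb{N}^n$ with $\lambda_1\ge\cdots\ge\lambda_n\ge0$. The monomial symmetric function $m_\lambda(x)$ is the sum of $x_1^{\nu_1}\cdots x_n^{\nu_n}$ over all distinct permutations $\nu$ of $\lambda$; the $m_\lambda$ form a basis of $\mathbb{C}[x_1,\ldots,x_n]^{S_n}$. The normalized version is $\bar m_\lambda(x)=m_\lambda(x)/m_\lambda(1,\ldots,1)$. $Q_z$ maps $\mathbb{C}[x_1,\ldots,x_n]^{S_n}$ to $\mathbb{C}[x_1,\ldots,x_n]^{S_n}\otimes\mathbb{C}[z]$; in products of several $Q_{z_j}$ each one acts on the $x$-variables, linearly over the polynomials in the other $z$'s. For $k=0,\ldots,n$, $\rho_k$ is the specialization of the variables $x_{k+1},\ldots,x_n$ to $1$: $(\rho_kf)(x_1,\ldots,x_k)=f(x_1,\ldots,x_k,1,\ldots,1)$; in particular $\rho_0f=f(1,\ldots,1)$ and $\rho_n$ is the identity. It leaves the $z$-variables untouched. *)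

(* Defs.v *)
From HB Require Import structures.
From mathcomp Require Import all_boot all_order all_fingroup all_algebra.
From mathcomp Require Import mpoly.

Set Implicit Arguments.
Unset Strict Implicit.
Unset Printing Implicit Defensive.

Import GRing.Theory.

Local Open Scope ring_scope.

(* The ring R[x_1, ..., x_n]^{S_n}. *)
Record sympoly (n : nat) (R : comNzRingType) : predArgType :=
  SymPoly { sympoly_val :> {mpoly R[n]}; _ : sympoly_val \is symmetric }.

Section SymPolyStructures.
Variables (n : nat) (R : comNzRingType).

HB.instance Definition _ := [isSub of sympoly n R for @sympoly_val n R].
HB.instance Definition _ := [Choice of sympoly n R by <:].
HB.instance Definition _ := [SubChoice_isSubComNzRing of sympoly n R by <:].
HB.instance Definition _ := [SubZmodule_isSubLmodule of sympoly n R by <:].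
HB.instance Definition _ :=
  [SubNzRing_SubLmodule_isSubLalgebra of sympoly n R by <:].
HB.instance Definition _ := [SubLalgebra_isSubAlgebra of sympoly n R by <:].

End SymPolyStructures.

(* A partition of length n is an n-tuple lam with sorted geq lam.  The
   duplicate-free list [permutations lam] consists of the distinct
   rearrangements of lam. *)
Definition monomial_poly (n : nat) (R : comNzRingType) (lam : n.-tuple nat) :
    {mpoly R[n]} :=
  \sum_(nu <- permutations lam) 'X_[ [multinom nth 0%N nu i | i < n] ].

Lemma monomial_poly_sym n (R : comNzRingType) (lam : n.-tuple nat) :
  monomial_poly R lam \is symmetric.
Proof.
have coefE m : (monomial_poly R lam)@_m = (perm_eq m lam)%:R.
  rewrite /monomial_poly raddf_sum /=.
  have [m_lam|m_lam] := boolP (perm_eq m lam); last first.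
    rewrite big_seq big1 // => nu; rewrite mem_permutations => nu_lam.
    rewrite mcoeffX; case: eqP => // mE; case/negP: m_lam.
    have sz : size nu = n by rewrite (perm_size nu_lam) size_tuple.
    rewrite (_ : tval m = nu) //; apply: (@eq_from_nth _ 0%N).
      by rewrite size_tuple sz.
    rewrite size_tuple => i lt_in.
    by rewrite -mE -(mnm_nth _ _ (Ordinal lt_in)) mnmE.
  rewrite (bigD1_seq (m : seq nat)) ?permutations_uniq ?mem_permutations //=.
  rewrite mcoeffX big_seq_cond big1 ?addr0 => [|nu /andP[]].
    by case: eqP => // -[]; apply/mnmP => i; rewrite mnmE -mnm_nth.
  rewrite mem_permutations => nu_lam neq; rewrite mcoeffX.
  case: eqP => // mE; case/eqP: neq.
  have sz : size nu = n by rewrite (perm_size nu_lam) size_tuple.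
  apply/esym/(@eq_from_nth _ 0%N); first by rewrite size_tuple sz.
  rewrite size_tuple => i lt_in.
  by rewrite -mE -(mnm_nth _ _ (Ordinal lt_in)) mnmE.
apply/issymP => s; apply/mpolyP => m; rewrite mcoeff_sym !coefE.
congr (nat_of_bool _)%:R; apply: (permPl _ _); apply/tuple_permP; exists s.
by congr tval; apply/eq_from_tnth => i; rewrite !tnth_mktuple.
Qed.

Definition monomial_sympoly n (R : comNzRingType) (lam : n.-tuple nat) :
    sympoly n R :=
  SymPoly (monomial_poly_sym R lam).

Definition norm_monomial n (F : fieldType) (lam : n.-tuple nat) : sympoly n F :=
  ((monomial_poly F lam).@[fun=> 1])^-1 *: monomial_sympoly F lam.

(* q_lam(z): the variable of index 0 is sent to z = 'X, all others to 1. *)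
Definition q_poly n (F : fieldType) (lam : n.-tuple nat) : {poly F} :=
  mmap (@polyC F) (fun i : 'I_n => if i == 0%N :> nat then 'X else 1)
       (norm_monomial F lam : {mpoly F[n]}).

Section Specialization.
Variables (R : comNzRingType) (n k : nat).

Definition ones_tuple : n.-tuple {mpoly R[k]} :=
  [tuple if insub (i : nat) is Some j then 'X_(j : 'I_k) else 1 | i < n].

Hypothesis le_kn : (k <= n)%N.

Lemma specialize_sym (p : {mpoly R[n]}) :
  p \is symmetric -> p \mPo ones_tuple \is symmetric.
Proof.
have tE : ones_tuple = [seq 'X_j | j <- enum 'I_k] ++ nseq (n - k) 1
    :> seq {mpoly R[k]}.
  apply: (@eq_from_nth _ 0).
    by rewrite size_tuple size_cat size_map size_enum_ord size_nseq subnKC.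
  rewrite size_tuple => i lt_in.
  rewrite -[i]/(val (Ordinal lt_in)) -tnth_nth tnth_mktuple nth_cat.
  rewrite size_map size_enum_ord /=; case: insubP => [j lt_ik vj|].
    by rewrite lt_ik (nth_map j) ?size_enum_ord // -vj nth_ord_enum.
  rewrite -leqNgt => le_ki; rewrite ltnNge le_ki nth_nseq.
  by rewrite ltn_sub2r // (leq_ltn_trans le_ki).
move=> sym_p; apply: msym_comp_poly => // s.
have -> : [tuple msym s ones_tuple`_i | i < n] = map (msym s) ones_tuple
    :> seq {mpoly R[k]}.
  apply: (@eq_from_nth _ 0); first by rewrite size_map !size_tuple.
  rewrite size_tuple => i lt_in; rewrite -[i]/(val (Ordinal lt_in)).
  by rewrite -tnth_nth tnth_mktuple (nth_map 0) ?size_tuple.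
rewrite tE map_cat map_nseq msym1 perm_cat2r -map_comp perm_sym.
rewrite (@eq_map _ _ _ ((fun j => 'X_j) \o s)) => [|j /=]; last first.
  rewrite msymX; congr 'X_[_]; apply/mnmP => i.
  by rewrite !mnmE (can2_eq (permK s) (permKV s)).
rewrite map_comp; apply/perm_map/uniq_perm; last 1 first.
- move=> j; rewrite mem_enum; apply/mapP; exists ((s^-1)%g j).
    by rewrite mem_enum.
  by rewrite permKV.
- by rewrite map_inj_uniq ?enum_uniq //; apply: perm_inj.
- exact: enum_uniq.
Qed.

(* rho_k: x_{k+1}, ..., x_n are set to 1. *)
Definition rho (f : sympoly n R) : sympoly k R :=
  SymPoly (specialize_sym (valP f)).

End Specialization.

(* Encodings: for an algebra A, A ⊗ C[z] is {poly A} and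
   A ⊗ C[z_1, ..., z_n] is {mpoly A[n]}.  The C-linear maps U -> A ⊗ C[z] are
   those linear for the scaling law [in_alg A \; *:%R]. *)
Notation "{ 'linz' U -> A }" :=
  {linear U -> {poly A} | GRing.in_alg A \; *:%R}
  (at level 0, U at level 98, A at level 99,
   format "{ 'linz'  U  ->  A }") : type_scope.

(* The inclusion C[z] -> A ⊗ C[z]. *)
Definition in_polyalg (R : comNzRingType) (A : lalgType R) (p : {poly R}) :
    {poly A} :=
  map_poly (GRing.in_alg A) p.

(* The map A ⊗ C[z] -> A ⊗ C[z_1, ..., z_n], z |-> z_j. *)
Definition at_z (A : nzRingType) n (j : 'I_n) (p : {poly A}) : {mpoly A[n]} :=
  (map_poly (@mpolyC n A) p).['X_j].

Section SeparatingOperator.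
Variables (R : comNzRingType) (n : nat).
Variable Q : sympoly n R -> {poly sympoly n R}.

(* Q_{z_j} acting on the coefficients (i.e. on the x-variables) of a
   polynomial in z_1, ..., z_n. *)
Definition Q_ext (j : 'I_n) (p : {mpoly (sympoly n R)[n]}) :
    {mpoly (sympoly n R)[n]} :=
  \sum_(a <- msupp p) at_z j (Q p@_a) * 'X_[a].

(* S_n = rho_0 Q_{z_1} ... Q_{z_n}. *)
Definition sep_op (f : sympoly n R) : {mpoly (sympoly 0 R)[n]} :=
  map_mpoly (@rho R n 0 (leq0n n)) (foldr Q_ext f%:MP (enum 'I_n)).

End SeparatingOperator.

(* Main.v *)
(* Since q_lam(z) is the average of the z^(lam_i), Q_z is the average over i of
   the dilations f |-> f(x_1, ..., z x_i, ..., x_n).  If rho_k f = 0, each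
   dilated function vanishes at (x_1, ..., x_(k-1), 1, ..., 1): at most k of its
   arguments are then different from 1, and f is symmetric.  So rho_(k-1) Q_z
   factors through rho_k.  Uniqueness holds because rho_k is surjective: setting
   one variable to 1 sends e_(r+1) to e_(r+1) + e_r, hence all elementary
   symmetric polynomials are in the image. *)
Require Import Defs.
From HB Require Import structures.
From mathcomp Require Import all_boot all_order all_fingroup all_algebra.
From mathcomp Require Import reals.
From mathcomp Require Import complex.
From mathcomp Require Import mpoly.

Set Implicit Arguments.
Unset Strict Implicit.
Unset Printing Implicit Defensive.

Import GRing.Theory Num.Theory.

Local Open Scope ring_scope.

(** * Evaluation of multivariate polynomials and substitution *)

Lemma eq_mmap n (R S : nzRingType) (f g : R -> S) (v w : 'I_n -> S) :
  f =1 g -> v =1 w -> mmap f v =1 mmap g w.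
Proof.
move=> fg vw p; apply: eq_bigr => m _; rewrite fg; congr (_ * _).
exact: mmap1_eq.
Qed.

Lemma rmorph_mmap n (R S T : nzRingType) (g : {rmorphism S -> T}) (f : R -> S)
    (v : 'I_n -> S) (p : {mpoly R[n]}) :
  g (mmap f v p) = mmap (g \o f) (g \o v) p.
Proof.
rewrite /mmap rmorph_sum; apply: eq_bigr => m _; rewrite rmorphM; congr (_ * _).
by rewrite /mmap1 rmorph_prod; apply: eq_bigr => i _; rewrite rmorphXn.
Qed.

Lemma mmap_mmap n k (R : nzRingType) (S : comNzRingType)
    (f : {rmorphism R -> S}) (t : 'I_n -> {mpoly R[k]}) (w : 'I_k -> S) p :
  mmap f w (mmap (@mpolyC k R) t p) = mmap f (fun i => mmap f w (t i)) p.
Proof. by rewrite rmorph_mmap; apply: eq_mmap => // c /=; rewrite mmapC. Qed.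

Lemma mmap_sym n (R : nzRingType) (S : comNzRingType) (f : {rmorphism R -> S})
    (v : 'I_n -> S) (s : 'S_n) p :
  p \is symmetric -> mmap f (v \o s) p = mmap f v p.
Proof.
(* [msym s p] is itself a substitution, of ['X_(s i)] for ['X_i], so [mmap_mmap] composes it with
   [v]. *)
move=> /issymP/(_ s) {2}<-; rewrite [RHS]mmap_mmap.
by apply: eq_mmap => // i; rewrite mmapX mmap1U.
Qed.

(** The way a hypothesis [rho_k f = 0] gets used: it forces [f] to vanish at every point, in any
    commutative algebra, whose coordinates after the first [k] are 1. *)
Lemma mmap_specialize n k (R : comNzRingType) (S : comNzRingType)
    (f : {rmorphism R -> S}) (le_kn : (k <= n)%N) (v : 'I_n -> S) p :
    (forall i : 'I_n, (k <= i)%N -> v i = 1) ->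
  mmap f v p = mmap f (v \o widen_ord le_kn) (p \mPo ones_tuple R n k).
Proof.
move=> v1; rewrite [RHS]mmap_mmap; apply: eq_mmap => // i.
rewrite tnth_mktuple; case: insubP => [j lt_ik vj|].
  by rewrite mmapX mmap1U /=; congr v; apply/val_inj.
by rewrite -leqNgt rmorph1 => /v1.
Qed.

(** * The specialization as an algebra morphism *)

Section Rho.
Variables (R : comNzRingType) (n k : nat) (le_kn : (k <= n)%N).

Lemma rho_is_linear : linear (@rho R n k le_kn).
Proof. by move=> a f g; apply/val_inj; rewrite /= linearP. Qed.

HB.instance Definition _ :=
  GRing.isLinear.Build R (sympoly n R) (sympoly k R) *:%R (rho le_kn)
    rho_is_linear.

Lemma rho_is_monoid_morphism : monoid_morphism (@rho R n k le_kn).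
Proof.
by split=> [|f g]; apply/val_inj; rewrite /= ?rmorph1 ?rmorphM.
Qed.

HB.instance Definition _ :=
  GRing.isMonoidMorphism.Build (sympoly n R) (sympoly k R) (rho le_kn)
    rho_is_monoid_morphism.

Lemma rho_in_alg (a : R) :
  rho le_kn (GRing.in_alg (sympoly n R) a) = GRing.in_alg (sympoly k R) a.
Proof. by rewrite linearZ rmorph1. Qed.

End Rho.

(** * Surjectivity of the specialization *)

Section RhoSurjective.
Variables (R : comNzRingType) (k : nat).

(** Phrased inside [{mpoly R[k]}], where the image is a subalgebra and hence stable under polynomial
    expressions. *)
Definition is_specialization n (g : {mpoly R[k]}) :=
  exists2 f : {mpoly R[n]}, f \is symmetric & f \mPo ones_tuple R n k = g.

Lemma is_specialization_refl g : g \is symmetric -> is_specialization k g.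
Proof.
exists g => //; rewrite -[RHS]comp_mpoly_id; apply: eq_mmap => // i.
by rewrite !tnth_mktuple; case: insubP => [j _ /val_inj ->|]; rewrite ?ltn_ord.
Qed.

Section Closure.
Variable n : nat.

Lemma is_specialization1 : is_specialization n 1.
Proof. by exists 1; rewrite ?rpred1 ?rmorph1. Qed.

Lemma is_specialization0 : is_specialization n 0.
Proof. by exists 0; rewrite ?rpred0 ?rmorph0. Qed.

Lemma is_specializationD g h :
  is_specialization n g -> is_specialization n h -> is_specialization n (g + h).
Proof.
by move=> [p ps <-] [q qs <-]; exists (p + q); rewrite ?rpredD ?rmorphD.
Qed.

Lemma is_specializationM g h :
  is_specialization n g -> is_specialization n h -> is_specialization n (g * h).
Proof.
by move=> [p ps <-] [q qs <-]; exists (p * q); rewrite ?rpredM ?rmorphM.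
Qed.

Lemma is_specializationZ a g :
  is_specialization n g -> is_specialization n (a *: g).
Proof. by move=> [p ps <-]; exists (a *: p); rewrite ?rpredZ ?linearZ. Qed.

Lemma is_specialization_comp l (t : l.-tuple {mpoly R[k]}) (p : {mpoly R[l]}) :
    (forall i, is_specialization n (tnth t i)) ->
  is_specialization n (p \mPo t).
Proof.
move=> t_n; rewrite comp_mpolyE.
elim/big_ind: _ => [||m _].
- exact: is_specialization0.
- exact: is_specializationD.
apply: is_specializationZ; elim/big_ind: _ => [||i _].
- exact: is_specialization1.
- exact: is_specializationM.
elim: (m i) => [|d IHd]; first exact: is_specialization1.
by rewrite exprS; apply: is_specializationM.
Qed.

End Closure.

Lemma mwiden_specialize n (p : {mpoly R[n]}) :
  mwiden p \mPo ones_tuple R n.+1 k = p \mPo ones_tuple R n k.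
Proof.
rewrite [LHS]mmap_mmap; apply: eq_mmap => // i.
by rewrite mmapX mmap1U !tnth_mktuple.
Qed.

(** Expand [e_(r+1)] along the last variable. Its index is [n], counting from 0, so [k <= n] ensures
    that it is set to 1. *)
Lemma mesym_specializeS n r : (k <= n)%N ->
  mesym n.+1 R r.+1 \mPo ones_tuple R n.+1 k
  = (mesym n R r.+1 \mPo ones_tuple R n k)
    + (mesym n R r \mPo ones_tuple R n k).
Proof.
move=> le_kn; rewrite mesymSS rmorphD rmorphM /= !mwiden_specialize.
congr (_ + _); rewrite [X in _ * X]mmapX mmap1U tnth_mktuple.
by rewrite insubF ?mulr1 //= ltnNge le_kn.
Qed.

(** By the fundamental theorem [f] is a polynomial in the elementary symmetric ones, so it suffices
    to reach their specializations. Solving [mesym_specializeS] for its first term does this by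
    induction on [r]. *)
Lemma is_specializationS n g :
  (k <= n)%N -> is_specialization n g -> is_specialization n.+1 g.
Proof.
move=> le_kn [f fs <-].
have mesym_n r : is_specialization n.+1 (mesym n R r \mPo ones_tuple R n k).
  elim: r => [|r IHr].
    by rewrite mesym0E rmorph1; apply: is_specialization1.
  have -> : mesym n R r.+1 \mPo ones_tuple R n k
      = (mesym n.+1 R r.+1 \mPo ones_tuple R n.+1 k)
        + (-1) *: (mesym n R r \mPo ones_tuple R n k).
    by rewrite mesym_specializeS // scaleN1r addrK.
  apply: is_specializationD; last exact: is_specializationZ.
  by exists (mesym n.+1 R r.+1); rewrite ?mesym_sym.
have [t [<- _]] := sym_fundamental fs.
rewrite [X in is_specialization _ X]mmap_mmap.
have -> : forall (v : 'I_n -> {mpoly R[k]}),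
    mmap (@mpolyC k R) v t = t \mPo [tuple v i | i < n].
  by move=> v; apply: eq_mmap => // i; rewrite tnth_mktuple.
by apply: is_specialization_comp => i; rewrite !tnth_mktuple; apply: mesym_n.
Qed.

(** Start with [k] variables, where nothing is specialized, and add one variable at a time. *)
Lemma rho_surj n (le_kn : (k <= n)%N) (g : sympoly k R) :
  exists f : sympoly n R, rho le_kn f = g.
Proof.
have: is_specialization n g.
  rewrite -(subnK le_kn); elim: (n - k)%N => [|d IHd].
    exact: is_specialization_refl (valP g).
  by rewrite addSn; apply: is_specializationS; rewrite ?leq_addl.
by case=> f fs fE; exists (SymPoly fs); apply/val_inj.
Qed.

End RhoSurjective.

(** * Monomial symmetric polynomials and the eigenvalues *)

Lemma sum_nth_perm n (V : nmodType) (G : nat -> V) (lam : n.-tuple nat) nu :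
  perm_eq nu lam -> \sum_(i < n) G (nth 0%N nu i) = \sum_(i < n) G (tnth lam i).
Proof.
move=> nu_lam; have sz : size nu = n by rewrite (perm_size nu_lam) size_tuple.
rewrite -[LHS](big_mkord xpredT (fun i => G (nth 0%N nu i))) -[in LHS]sz.
by rewrite -(big_nth 0%N xpredT G) (perm_big _ nu_lam) /= big_tuple.
Qed.

Section Monomials.
Variables (n : nat) (R : comNzRingType).
Implicit Types (lam : n.-tuple nat) (m : 'X_{1..n}).

Lemma mcoeff_monomial_poly lam m :
  (monomial_poly R lam)@_m = (perm_eq m lam)%:R.
Proof.
(* Since [permutations lam] is duplicate-free, membership is a count, and both sides become sums of
   0-1 terms over the same list. *)
rewrite raddf_sum /= -mem_permutations -count_uniq_mem ?permutations_uniq //.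
rewrite -sum1_count natr_sum [RHS]big_mkcond /= big_seq [RHS]big_seq.
apply: eq_bigr => nu; rewrite mem_permutations => /perm_size.
rewrite size_tuple => sz; rewrite mcoeffX.
have -> : ([multinom nth 0%N nu i | i < n] == m) = (nu == m :> seq nat).
  apply/eqP/eqP => [<-|nuE]; last by apply/mnmP => i; rewrite mnmE nuE -mnm_nth.
  apply: (@eq_from_nth _ 0%N); first by rewrite size_tuple sz.
  by rewrite sz => i lt_in; rewrite -(mnm_nth _ _ (Ordinal lt_in)) mnmE.
by case: eqP.
Qed.

(** The coefficients of [f] are constant on rearrangements of an exponent, and each exponent [mu]
    has exactly one decreasing rearrangement, so a single term contributes to the coefficient at
    [mu]. *)
Lemma sympoly_monomialE (f : sympoly n R) :
  f = \sum_(m <- msupp f | sorted geq m)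
        f@_m *: monomial_sympoly R (m : n.-tuple nat).
Proof.
apply/val_inj; rewrite raddf_sum; apply/mpolyP => mu /=.
rewrite raddf_sum /=.
have geq_total : total geq by move=> x y; apply: leq_total.
have sz_mu : size (sort geq mu) == n by rewrite size_sort size_tuple.
pose lam := Multinom (Tuple sz_mu).
have perm_lam : perm_eq mu lam by rewrite perm_sym; apply/permPl/perm_sort.
have f_lam m : perm_eq mu m -> f@_mu = f@_m.
  case/tuple_permP => s muE; rewrite -(msym_coeff m s (valP f)).
  congr (_@__); apply/mnmP => i; rewrite mnmE (mnm_nth 0%N) muE.
  by rewrite -tnth_nth tnth_mktuple -mnm_tnth.
rewrite (eq_bigr (fun m => if m == lam then f@_mu else 0)) => [|m m_sorted].
  rewrite big_mkcond /=.
  have [lamP|lamN] := boolP (lam \in msupp f).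
    rewrite (bigD1_seq lam) ?msupp_uniq //= eqxx sort_sorted //.
    by rewrite big1 ?addr0 // => m /negbTE ->; case: ifP.
  rewrite big1_seq => [|m /andP[_ m_f]].
    by rewrite (f_lam _ perm_lam) (memN_msupp_eq0 lamN).
  by case: eqP m_f => [->|_ _]; [rewrite (negbTE lamN)|case: ifP].
rewrite mcoeffZ mcoeff_monomial_poly; case: eqP => [->|neq].
  by rewrite perm_lam mulr1 (f_lam _ perm_lam).
have [perm_m|_] := boolP (perm_eq mu m); last by rewrite mulr0.
case: neq; apply/val_inj/val_inj => /=; symmetry.
have anti : antisymmetric geq by move=> x y /anti_leq.
have tr : transitive geq by move=> x y z xy /leq_trans; apply.
apply: (sorted_eq tr anti); rewrite ?sort_sorted //.
by apply: perm_trans perm_m; apply/permPl/perm_sort.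
Qed.

End Monomials.

Section NormMonomials.
Variables (n : nat) (F : numFieldType).
Implicit Types lam : n.-tuple nat.

Lemma monomial_poly1 lam :
  (monomial_poly F lam).@[fun=> 1] = (size (permutations lam))%:R.
Proof.
rewrite raddf_sum /= -sum1_size natr_sum; apply: eq_bigr => nu _.
by rewrite mevalX big1 // => i _; rewrite expr1n.
Qed.

(** Characteristic 0 enters here: the value counts the rearrangements of [lam], one of which is
    [lam] itself. *)
Lemma monomial_poly1_neq0 lam : (monomial_poly F lam).@[fun=> 1] != 0.
Proof.
rewrite monomial_poly1 pnatr_eq0 -lt0n -has_predT; apply/hasP.
by exists (lam : seq nat); rewrite ?mem_permutations.
Qed.

Lemma norm_monomial_ind (P : sympoly n F -> Prop) :
    (forall lam, sorted geq lam -> P (norm_monomial F lam)) ->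
    P 0 -> (forall a f g, P f -> P g -> P (a *: f + g)) ->
  forall f, P f.
Proof.
move=> Pm P0 Plin f; rewrite [f]sympoly_monomialE.
elim/big_rec: _ => // m g m_sorted Pg; apply: (Plin) => //.
rewrite -[monomial_sympoly _ _](scalerKV (monomial_poly1_neq0 m)).
by rewrite -[X in P X]addr0; apply: Plin => //; apply: Pm.
Qed.

(** By symmetry, putting [z] in any one position and 1 elsewhere gives the same value. Summed over
    the positions, each rearrangement of [lam] contributes the right-hand side. The factor [n]
    avoids a division and makes [n = 0] harmless. *)
Lemma q_polyE lam :
  n%:R * q_poly F lam = \sum_(i < n) 'X^(tnth lam i).
Proof.
pose E i := mmap (@polyC F) (fun j : 'I_n => if j == i then 'X else 1)
  (monomial_poly F lam).
have E_sum i : E i = \sum_(nu <- permutations lam) 'X^(nth 0%N nu i).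
  rewrite /E raddf_sum; apply: eq_bigr => nu _; rewrite /= mmapX /mmap1.
  rewrite (bigD1 i) //= eqxx mnmE big1 ?mulr1 // => j /negbTE ->.
  exact: expr1n.
have E_const i j : E i = E j.
  rewrite /E -(mmap_sym _ _ (tperm i j) (monomial_poly_sym F lam)).
  apply: eq_mmap => // l /=.
  by rewrite -(inj_eq (@perm_inj _ (tperm i j))) tpermK tpermL.
have sum_E : \sum_i E i
    = (size (permutations lam))%:R * \sum_(i < n) 'X^(tnth lam i).
  under eq_bigr do rewrite E_sum.
  rewrite exchange_big -sum1_size natr_sum mulr_suml.
  rewrite big_seq [RHS]big_seq; apply: eq_bigr => nu.
  rewrite mem_permutations mul1r.
  exact: sum_nth_perm.
case: (posnP n) => [n0|n_gt0].
  have -> : n%:R = 0 :> {poly F} by rewrite n0.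
  by rewrite mul0r big1 // => i; have := leq_trans (ltn_ord i) (eq_leq n0).
have -> : q_poly F lam
    = ((monomial_poly F lam).@[fun=> 1])^-1%:P * E (Ordinal n_gt0).
  exact: mmapZ.
have sum_E0 : n%:R * E (Ordinal n_gt0) = \sum_i E i.
  rewrite (eq_bigr (fun=> E (Ordinal n_gt0))) => [|i _]; last exact: E_const.
  by rewrite sumr_const card_ord mulr_natl.
rewrite mulrCA sum_E0 sum_E monomial_poly1 mulrA -polyC_natr -polyCM.
by rewrite -monomial_poly1 mulVf ?mul1r // monomial_poly1_neq0.
Qed.

End NormMonomials.

(** A single dilation does not preserve symmetry. These structures let [map_poly] carry [Q f] to
    coefficients in [{mpoly R[n]}], where it can be compared with dilations. *)
HB.instance Definition _ n (R : comNzRingType) :=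
  GRing.isLinear.Build R (sympoly n R) {mpoly R[n]} *:%R (@sympoly_val n R)
    (fun a f g => erefl).
HB.instance Definition _ n (R : comNzRingType) :=
  GRing.isMonoidMorphism.Build (sympoly n R) {mpoly R[n]} (@sympoly_val n R)
    (conj erefl (fun f g => erefl)).

(** * Dilations of single variables *)

Section Dilation.
Variables (F : numFieldType) (n : nat).
Implicit Type f : {mpoly F[n]}.

(* f(x_1, ..., z x_i, ..., x_n) *)
Definition dilation (i : 'I_n) f : {poly {mpoly F[n]}} :=
  mmap (polyC \o @mpolyC n F) (fun j => 'X ^+ (j == i) * ('X_j)%:P) f.

Lemma dilationX i m : dilation i 'X_[m] = 'X^(m i) * ('X_[m])%:P.
Proof.
rewrite /dilation mmapX /mmap1 mpolyXE_id rmorph_prod /=.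
under eq_bigr do rewrite exprMn; rewrite big_split /=; congr (_ * _).
  rewrite (bigD1 i) //= eqxx big1 ?mulr1 // => j /negbTE ->; exact: expr1n.
by apply: eq_bigr => j _; rewrite rmorphXn.
Qed.

Lemma dilation_linear i a f g :
  dilation i (a *: f + g) = (a%:MP)%:P * dilation i f + dilation i g.
Proof. by rewrite /dilation mmapD mmapZ. Qed.

Lemma sum_dilation_linear a f g :
  \sum_i dilation i (a *: f + g)
  = (a%:MP)%:P * (\sum_i dilation i f) + \sum_i dilation i g.
Proof.
rewrite mulr_sumr -big_split; apply: eq_bigr => i _; exact: dilation_linear.
Qed.

(** Dilating [x^nu] in position [i] multiplies it by [z^(nu_i)]; the sum of these factors over [i]
    is the same for all rearrangements [nu] of [lam]. *)
Lemma sum_dilation_monomial (lam : n.-tuple nat) :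
  \sum_i dilation i (monomial_poly F lam)
  = (\sum_(i < n) 'X^(tnth lam i)) * (monomial_poly F lam)%:P.
Proof.
under eq_bigr do rewrite [dilation _ _]raddf_sum /=.
rewrite exchange_big rmorph_sum mulr_sumr /=.
rewrite big_seq [RHS]big_seq; apply: eq_bigr => nu.
rewrite mem_permutations => nu_lam.
under eq_bigr do rewrite [mmap _ _ _]dilationX mnmE.
by rewrite -mulr_suml (sum_nth_perm _ nu_lam).
Qed.

Lemma sum_dilation_norm_monomial (lam : n.-tuple nat) :
  \sum_i dilation i (norm_monomial F lam : {mpoly F[n]})
  = (\sum_(i < n) 'X^(tnth lam i)) * (norm_monomial F lam : {mpoly F[n]})%:P.
Proof.
(* Adding 0 produces the shape [a *: f + g] of [dilation_linear]. *)
rewrite /norm_monomial /=; set c := _^-1; rewrite -[c *: _]addr0.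
under eq_bigr do rewrite dilation_linear [dilation _ 0]raddf0 addr0.
rewrite -mulr_sumr sum_dilation_monomial addr0 -mul_mpolyC polyCM.
by rewrite mulrCA.
Qed.

End Dilation.

(** * The operator as an average of dilations, and the kernel of the specialization *)

Section EigenOperator.
Variables (F : numFieldType) (n : nat).
Variable Q : {linz sympoly n F -> sympoly n F}.
Hypothesis Q_spec : forall lam : n.-tuple nat, sorted geq lam ->
  Q (norm_monomial F lam) =
    in_polyalg (sympoly n F) (q_poly F lam) * (norm_monomial F lam)%:P.

(** Both sides are linear in [f], and [q_polyE] makes them agree on the normalized monomials of
    partitions. *)
Lemma sum_dilationE (f : sympoly n F) :
  \sum_i dilation i (f : {mpoly F[n]})
  = n%:R * map_poly (@sympoly_val n F) (Q f).
Proof.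
move: f; apply: norm_monomial_ind => [lam lam_sorted||a f g IHf IHg].
- rewrite sum_dilation_norm_monomial Q_spec // rmorphM /= map_polyC /= mulrA.
  congr (_ * _); rewrite -map_poly_comp.
  rewrite (eq_map_poly (g := @mpolyC n F)) => [|c /=]; last first.
    by rewrite -alg_mpolyC.
  rewrite -(rmorph_nat (map_poly (@mpolyC n F))) -rmorphM /= q_polyE rmorph_sum.
  by apply: eq_bigr => i _; rewrite /= map_polyXn.
- rewrite [Q 0]raddf0 map_poly0 mulr0 big1 // => i _.
  by rewrite /dilation [mmap _ _ _]raddf0.
- rewrite [Q _]linearP [map_poly _ _]rmorphD [RHS]mulrDr.
  have -> : sympoly_val (a *: f + g) = a *: sympoly_val f + sympoly_val g by [].
  rewrite [LHS]sum_dilation_linear; congr (_ + _); last exact: IHg.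
  transitivity ((a%:MP)%:P * (n%:R * map_poly (@sympoly_val n F) (Q f))).
    by congr (_ * _).
  rewrite [LHS]mulrCA; congr (_ * _).
  by rewrite /= -!mul_polyC rmorphM /= map_polyC /= alg_mpolyC.
Qed.

End EigenOperator.

(** At most [k.+1] coordinates of [v] can differ from 1: those of index below [k] and the one at
    [i]. A permutation brings them to the front, which symmetry of [p] allows. *)
Lemma mmap_specialize_eq0 n k (R S : comNzRingType) (f : {rmorphism R -> S})
    (v : 'I_n -> S) (i : 'I_n) (p : {mpoly R[n]}) :
    (k < n)%N -> p \is symmetric -> p \mPo ones_tuple R n k.+1 = 0 ->
    (forall j : 'I_n, j != i -> (k <= j)%N -> v j = 1) ->
  mmap f v p = 0.
Proof.
move=> lt_kn p_sym p0 v1.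
suff [s vs1] : exists s : 'S_n, forall j : 'I_n, (k < j)%N -> v (s j) = 1.
  by rewrite -(mmap_sym _ _ s p_sym) (mmap_specialize _ lt_kn) // p0 raddf0.
have [lt_ik|le_ki] := ltnP i k.
  exists 1%g => j lt_kj; rewrite perm1 v1 //; last exact: ltnW.
  by apply: contraTneq lt_kj => ->; rewrite -leqNgt ltnW.
(* Index [k] is the last position left free by the specialization to [k.+1] variables; [i] is moved
   there. *)
exists (tperm i (Ordinal lt_kn)) => j lt_kj.
case: tpermP => [ji|jk|/eqP neq_ji _]; last exact: v1 neq_ji (ltnW lt_kj).
  by apply: v1 => //; rewrite -ji -val_eqE /= ltn_eqF.
by rewrite jk ltnn in lt_kj.
Qed.

(** The kernel inclusion behind the factorization. After multiplication by [n], which is cancellable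
    since [k < n] and the characteristic is 0, each specialized dilation of [f] vanishes
    separately. *)
Lemma rho_eq0_eigen (F : numFieldType) n k
    (Q : {linz sympoly n F -> sympoly n F})
    (lt_kn : (k < n)%N) (le_kn : (k <= n)%N) (f : sympoly n F) :
    (forall lam : n.-tuple nat, sorted geq lam ->
       Q (norm_monomial F lam) =
         in_polyalg (sympoly n F) (q_poly F lam) * (norm_monomial F lam)%:P) ->
  rho lt_kn f = 0 -> map_poly (rho le_kn) (Q f) = 0.
Proof.
move=> Q_spec /(congr1 val) /= f0.
have n_neq0 : n%:R != 0 :> {poly {mpoly F[k]}}.
  rewrite -polyC_natr -mpolyC_nat polyC_eq0 mpolyC_eq0 pnatr_eq0.
  by rewrite -lt0n (leq_ltn_trans _ lt_kn).
apply: (map_inj_poly (f := @sympoly_val k F)) => //; first exact: val_inj.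
rewrite map_poly0; apply: (mulfI n_neq0); rewrite mulr0.
pose spec := map_poly (comp_mpoly (ones_tuple F n k)).
have -> : n%:R * map_poly (@sympoly_val k F) (map_poly (rho le_kn) (Q f))
    = spec (n%:R * map_poly (@sympoly_val n F) (Q f)).
  by rewrite /spec rmorphM rmorph_nat /= -!map_poly_comp.
rewrite -(sum_dilationE Q_spec) /spec raddf_sum big1 // => i _ /=.
(* A dilation followed by specialization is one evaluation of [f]: [phi] embeds the scalars, and
   coordinate [j] is entry [j] of [ones_tuple], times [z] when [j = i]. *)
pose phi : {rmorphism F -> {poly {mpoly F[k]}}} :=
  map_poly (comp_mpoly (ones_tuple F n k)) \o (polyC \o @mpolyC n F).
rewrite rmorph_mmap; apply: (mmap_specialize_eq0 phi (i := i) lt_kn) => //.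
  exact: valP.
move=> j /negbTE neq_ji le_kj /=.
rewrite neq_ji mul1r map_polyC /= comp_mpolyXU -tnth_nth tnth_mktuple.
by rewrite insubF // ltnNge le_kj.
Qed.

(** * Factoring linear maps through a surjection *)

Lemma linear_factor (R : pzRingType) (U V : lmodType R) (W : zmodType)
    (s : GRing.Scale.law R W) (h : {linear U -> V}) (g : {linear U -> W | s}) :
    (forall v, exists u, h u = v) -> (forall u, h u = 0 -> g u = 0) ->
  exists g' : {linear V -> W | s}, forall u, g u = g' (h u).
Proof.
move=> h_surj ker_hg.
(* The boolean form is what [xchoose] requires. By [ker_hg] the value of [g] does not depend on the
   chosen preimage. *)
have h_surjb v : exists u, h u == v by have [u <-] := h_surj v; exists u.
pose g' v := g (xchoose (h_surjb v)).
have g'E u : g u = g' (h u).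
  apply/eqP; rewrite -subr_eq0 -raddfB; apply/eqP/ker_hg.
  by rewrite raddfB /= (eqP (xchooseP (h_surjb (h u)))) subrr.
have g'_linear : linear_for s g'.
  move=> a v w; have [[u <-] [t <-]] := (h_surj v, h_surj w).
  by rewrite -linearP -!g'E linearP.
pose gL := GRing.isLinear.Build R V W s g' g'_linear.
pose G : {linear V -> W | s} := HB.pack g' gL.
by exists G.
Qed.

(** Used to package [rho_(k-1) Q_z] as a linear map. The scaling law passes from [A] to [B] because
    [r] sends [a *: 1] to [a *: 1]. *)
Lemma linz_map_poly (R : comNzRingType) (U : lmodType R) (A B : algType R)
    (r : {lrmorphism A -> B}) (Q : {linz U -> A}) :
  exists rQ : {linz U -> B}, forall u, rQ u = map_poly r (Q u).
Proof.
pose rQ u := map_poly r (Q u).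
have rQ_linear : linear_for (GRing.in_alg B \; *:%R) rQ.
  move=> a u v; rewrite /rQ linearP rmorphD; congr (_ + _) => /=.
  by rewrite linearZ_LR /= linearZ rmorph1.
pose rQL := GRing.isLinear.Build R U {poly B} _ rQ rQ_linear.
pose G : {linz U -> B} := HB.pack rQ rQL.
by exists G.
Qed.

(** * The separating operator on an eigenvector *)

Section SeparatingOperatorEigen.
Variables (R : comNzRingType) (n : nat).

Lemma at_zM (A : comNzRingType) (j : 'I_n) (p q : {poly A}) :
  at_z j (p * q) = at_z j p * at_z j q.
Proof. by rewrite /at_z rmorphM hornerM. Qed.

Lemma at_zC (A : nzRingType) (j : 'I_n) (a : A) : at_z j a%:P = a%:MP.
Proof. by rewrite /at_z map_polyC hornerC. Qed.

Lemma at_z_map (A B : nzRingType) (g : {rmorphism A -> B}) (j : 'I_n) p :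
  at_z j (map_poly g p) = map_mpoly g (at_z j p).
Proof.
rewrite /at_z -horner_map /= map_mpolyX -!map_poly_comp; congr (_.[_]).
by apply: eq_map_poly => a /=; rewrite /map_mpoly mmapC.
Qed.

Variable Q : {linz sympoly n R -> sympoly n R}.
Variables (f : sympoly n R) (q : {poly R}).
Hypothesis Qf : Q f = in_polyalg (sympoly n R) q * f%:P.

Local Notation inA := (map_mpoly (GRing.in_alg (sympoly n R))).

Lemma Q_scale_eigen (a : R) :
  Q (a *: f) = in_polyalg (sympoly n R) q * (a *: f)%:P.
Proof.
rewrite linearZ_LR /= Qf -mul_polyC mulrCA -polyCM.
by congr (_ * polyC _); apply: mulr_algl.
Qed.

Lemma Q_ext_coef_eigen (j : 'I_n) (p : {mpoly (sympoly n R)[n]}) :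
    (forall m, Q p@_m = in_polyalg (sympoly n R) q * (p@_m)%:P) ->
  Q_ext Q j p = at_z j (in_polyalg (sympoly n R) q) * p.
Proof.
move=> Qp; rewrite [X in _ = _ * X]mpolyE mulr_sumr; apply: eq_bigr => m _.
by rewrite Qp at_zM at_zC -mulrA mul_mpolyC.
Qed.

(** The invariant is a product of [f] with a polynomial in the [z_j] having scalar coefficients:
    each coefficient is a multiple of [f], so the next operator again multiplies by [q]. *)
Lemma foldr_Q_ext_eigen (s : seq 'I_n) :
  foldr (Q_ext Q) f%:MP s = f%:MP * inA (\prod_(j <- s) at_z j q).
Proof.
elim: s => [|j s IHs]; first by rewrite big_nil rmorph1 mulr1.
rewrite [LHS]/= IHs Q_ext_coef_eigen => [|m].
  by rewrite big_cons mulrCA [in RHS]rmorphM at_z_map.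
rewrite mcoeffCM mcoeff_map_mpoly.
move: (mcoeff _ _) => a.
have -> : f * GRing.in_alg _ a = a *: f by rewrite mulrC mulr_algl.
exact: Q_scale_eigen.
Qed.

Lemma sep_op_eigen :
  rho (leq0n n) f = 1 ->
  sep_op Q f = \prod_(j < n) at_z j (in_polyalg (sympoly 0 R) q).
Proof.
move=> f1; rewrite /sep_op foldr_Q_ext_eigen rmorphM /=.
rewrite [X in X * _]mmapC /= f1 mul1r enumT -/(index_enum _) !rmorph_prod /=.
apply: eq_bigr => j _; rewrite -!at_z_map -map_poly_comp; congr at_z.
by apply: eq_map_poly => a; apply: rho_in_alg.
Qed.

End SeparatingOperatorEigen.

Lemma rho0_norm_monomial (F : numFieldType) n (lam : n.-tuple nat) :
  rho (leq0n n) (norm_monomial F lam) = 1.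
Proof.
apply/val_inj; rewrite /= linearZ /=.
(* With no variable left, every entry of [ones_tuple] is 1, so the composition is a constant. *)
have -> : monomial_poly F lam \mPo ones_tuple F n 0
    = ((monomial_poly F lam).@[fun=> 1])%:MP.
  rewrite [RHS]rmorph_mmap; apply: eq_mmap => // i /=.
  by rewrite tnth_mktuple insubF // rmorph1.
by rewrite -mul_mpolyC -mpolyCM mulVf ?mpolyC1 // monomial_poly1_neq0.
Qed.

(** * Existence and uniqueness of the factored operators *)

Lemma specialized_operator (F : numFieldType) n k
    (Q : {linz sympoly n F -> sympoly n F})
    (lt_kn : (k < n)%N) (le_kn : (k <= n)%N) :
    (forall lam : n.-tuple nat, sorted geq lam ->
       Q (norm_monomial F lam) =
         in_polyalg (sympoly n F) (q_poly F lam) * (norm_monomial F lam)%:P) ->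
  exists A : {linz sympoly k.+1 F -> sympoly k F},
    forall f, map_poly (rho le_kn) (Q f) = A (rho lt_kn f).
Proof.
move=> Q_spec; have [rhoQ rhoQE] := linz_map_poly (rho le_kn) Q.
have ker_rho f : rho lt_kn f = 0 -> rhoQ f = 0.
  by rewrite rhoQE; apply: rho_eq0_eigen.
have [A AE] := linear_factor (rho_surj lt_kn) ker_rho.
by exists A => f; rewrite -rhoQE AE.
Qed.

Theorem proposition2p2 (R : realType) (n : nat)
    (Q : {linz sympoly n R[i] -> sympoly n R[i]})
    (Q_spec : forall lam : n.-tuple nat, sorted geq lam ->
       Q (norm_monomial R[i] lam) =
         in_polyalg (sympoly n R[i]) (q_poly R[i] lam)
           * (norm_monomial R[i] lam)%:P) :
  (forall lam : n.-tuple nat, sorted geq lam ->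
     sep_op Q (norm_monomial R[i] lam) =
       \prod_(j < n) at_z j (in_polyalg (sympoly 0 R[i]) (q_poly R[i] lam)))
  /\
  forall (k : nat) (k_gt0 : (0 < k)%N) (le_kn : (k <= n)%N),
    let le_k1n : (k.-1 <= n)%N := leq_trans (leq_pred k) le_kn in
    exists A : {linz sympoly k R[i] -> sympoly k.-1 R[i]},
      (forall f : sympoly n R[i],
         map_poly (rho le_k1n) (Q f) = A (rho le_kn f))
      /\
      (forall A' : {linz sympoly k R[i] -> sympoly k.-1 R[i]},
         (forall f : sympoly n R[i],
            map_poly (rho le_k1n) (Q f) = A' (rho le_kn f)) ->
         A' =1 A).
Proof.
split=> [lam lam_sorted|[//|k] _ lt_kn le_kn].
  by apply: sep_op_eigen; [apply: Q_spec|apply: rho0_norm_monomial].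
have [A AE] := specialized_operator lt_kn le_kn Q_spec.
(* Every [g] is some [rho lt_kn f], and there the intertwining relation forces the value of the
   operator. *)
exists A; split=> // A' A'E g; have [f <-] := rho_surj lt_kn g.
by rewrite -A'E -AE.
Qed.
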